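(* Let $k>1$ be an odd integer and let $d=k^{2}+4$. Then all positive integer solutions $(x,y)$ of the equation $x^{2}-dy^{2}=-1$ are given by $$(x,y)=\left(\frac{V_{6n-3}(k,1)}{2},\frac{U_{6n-3}(k,1)}{2}\right)$$ with $n\geq 1$. That is, the set of pairs of positive integers solving the equation is exactly the set of these pairs as $n$ ranges over the integers $n\ge 1$.
   Context: For nonzero integers $k,s$ with $k^{2}+4s>0$, the generalized Fibonacci sequence is defined by $U_{0}(k,s)=0$, $U_{1}(k,s)=1$, $U_{n+1}(k,s)=kU_{n}(k,s)+sU_{n-1}(k,s)$ for $n\ge 1$, and the generalized Lucas sequence by $V_{0}(k,s)=2$, $V_{1}(k,s)=k$, $V_{n+1}(k,s)=kV_{n}(k,s)+sV_{n-1}(k,s)$ for $n\ge 1$. *)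

(* Defs.v *)
From mathcomp Require Import all_boot all_order all_algebra.

Set Implicit Arguments.
Unset Strict Implicit.
Unset Printing Implicit Defensive.

Import GRing.Theory.
Local Open Scope ring_scope.

(* The usual standing assumptions k, s <> 0 and k ^+ 2 + 4 * s > 0 are not
   built into these recurrences; both hold when k > 1 and s = 1. *)
Fixpoint genFib (k s : int) (n : nat) {struct n} : int :=
  match n with
  | 0%N => 0
  | m.+1 => match m with
            | 0%N => 1
            | p.+1 => k * genFib k s m + s * genFib k s p
            end
  end.

Fixpoint genLucas (k s : int) (n : nat) {struct n} : int :=
  match n with
  | 0%N => 2
  | m.+1 => match m with
            | 0%N => k
            | p.+1 => k * genLucas k s m + s * genLucas k s p
            end
  end.

(* Main.v *)
Require Import Defs.
From mathcomp Require Import all_boot all_order all_algebra.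
From mathcomp Require Import zify ring.

(** The substitution x = k y + z turns the Pell equation into a statement
    about the form q(u, z) = u ^ 2 - k u z - z ^ 2: with u = 2 y one has
    x ^ 2 - (k ^ 2 + 4) y ^ 2 = - q(u, z).

    The map (u, z) |-> (z, u - k z), which runs the Fibonacci recurrence
    backwards, changes the sign of q, and keeps a pair with q = 1 or -1
    nonnegative as long as z > 0.  As it lowers u + z, every such pair with
    u > 0 descends to (1, 0) = (U_1, U_0); hence it is a pair (U_(m+1), U_m)
    of consecutive Fibonacci numbers ([unit_norm_genFib]).

    It remains to see which m occur.  By Cassini's identity
    q(U_(m+1), U_m) = (-1) ^ m, so that m must be even.  For odd k the sequence
    U has period 3 modulo 2 ([even_genFib]), so that u = 2 y is even exactly
    when 3 divides m + 1.  Together these say that m + 1 is an odd multiple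
    of 3, that is, of the form 6 n - 3, and then 2 x = k u + 2 z is
    V_(m+1) ([genLucasE]). *)

Set Implicit Arguments.
Unset Strict Implicit.
Unset Printing Implicit Defensive.

Import Order.TTheory GRing.Theory Num.Theory.
Local Open Scope ring_scope.

Lemma genFibSS k s n :
  genFib k s n.+2 = k * genFib k s n.+1 + s * genFib k s n.
Proof. by []. Qed.

Lemma genLucasSS k s n :
  genLucas k s n.+2 = k * genLucas k s n.+1 + s * genLucas k s n.
Proof. by []. Qed.

Lemma genLucasE k s n :
  genLucas k s n.+1 = k * genFib k s n.+1 + 2 * s * genFib k s n.
Proof.
(* The recurrence has order two, so consecutive instances go together. *)
suff [] : genLucas k s n.+1 = k * genFib k s n.+1 + 2 * s * genFib k s n /\
  genLucas k s n.+2 = k * genFib k s n.+2 + 2 * s * genFib k s n.+1 by [].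
elim: n => [|n [IH1 IH2]]; first by rewrite /=; split; ring.
by split=> //; rewrite genLucasSS IH1 IH2 !genFibSS; ring.
Qed.

Lemma genFib_cassini k s n :
  genFib k s n.+1 ^+ 2 - k * genFib k s n.+1 * genFib k s n
    - s * genFib k s n ^+ 2 = (- s) ^+ n.
Proof.
elim: n => [|n IHn]; first by rewrite /= expr0; ring.
by rewrite [RHS]exprS -IHn genFibSS; ring.
Qed.

Lemma genFib_ge0 k s n : 0 <= k -> 0 <= s -> 0 <= genFib k s n.
Proof.
move=> k0 s0; suff [] : 0 <= genFib k s n /\ 0 <= genFib k s n.+1 by [].
elim: n => [|n [IH1 IH2]] //; split=> //.
by rewrite genFibSS addr_ge0 ?mulr_ge0.
Qed.

Lemma genFib_gt0 k s n : 0 < k -> 0 <= s -> 0 < genFib k s n.+1.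
Proof.
move=> k0 s0; elim: n => [|n IHn] //.
by rewrite genFibSS ltr_wpDr ?mulr_gt0 // mulr_ge0 // genFib_ge0 // ltW.
Qed.

(** Two steps of the recurrence give
    U_(n+3) = (k ^ 2 + 1) U_(n+1) + k U_n, which is U_n modulo 2 for
    odd k; the initial values are 0, 1, k. *)
Lemma even_genFib k n :
  ~~ (2 %| k)%Z -> (2 %| genFib k 1 n)%Z = (3 %| n)%N.
Proof.
move=> k_odd; have [j kE] : exists j, k = 2 * j + 1.
  by exists (k %/ 2)%Z; lia.
have period m : (2 %| genFib k 1 m.+3)%Z = (2 %| genFib k 1 m)%Z.
  have -> : genFib k 1 m.+3 = genFib k 1 m +
      2 * ((2 * j ^+ 2 + 2 * j + 1) * genFib k 1 m.+1 + j * genFib k 1 m).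
    by rewrite !genFibSS kE; ring.
  by rewrite rpredDr // dvdz_mulr.
have [m] := ubnP n; elim: m n => // m IHm [|[|[|n]]] lt_n_m //.
- by rewrite /= mulr0 addr0 mulr1; apply/negbTE.
- by rewrite period IHm; lia.
Qed.

(** Descent along the backward recurrence. With w = u - k z one has
    q(u, z) = u w - z ^ 2; if w < 0 < z, this is at most -2 as u > 0,
    so the hypothesis on q is what keeps the pair nonnegative. *)
Lemma unit_norm_genFib (k u z : int) :
    0 < k -> 0 < u -> 0 <= z ->
    `|u ^+ 2 - k * u * z - z ^+ 2| = 1 ->
  exists m, u = genFib k 1 m.+1 /\ z = genFib k 1 m.
Proof.
move=> k0; have [b] := ubnP `|(u + z)%R|%N.
elim: b u z => // b IHb u z lt_b u0 z0 norm1.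
have [zE|z_neq0] := eqVneq z 0.
  exists 0%N; split=> //=; move: norm1; rewrite zE; nia.
have z_gt0 : 0 < z by lia.
pose w := u - k * z; have uE : u = k * z + w by rewrite /w; ring.
have norm_w : `|z ^+ 2 - k * z * w - w ^+ 2| = 1.
  by rewrite -norm1 uE -normrN; congr `|_|; ring.
have w0 : 0 <= w.
  rewrite leNgt; apply/negP=> w_lt0.
  have normE : u ^+ 2 - k * u * z - z ^+ 2 = u * w - z ^+ 2.
    by rewrite uE; ring.
  have uw_lt0 : u * w < 0 by rewrite pmulr_rlt0.
  have z2_gt0 : 0 < z ^+ 2 by rewrite exprn_gt0.
  by move: norm1; rewrite normE; lia.
have lt_zw : (`|(z + w)%R| < b)%N.
  have kz : z <= k * z by rewrite ler_peMl.
  by rewrite uE in lt_b; clear uE norm1 norm_w IHb; lia.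
have [m [zE wE]] := IHb z w lt_zw z_gt0 w0 norm_w.
by exists m.+1; rewrite genFibSS -zE -wE mul1r.
Qed.

(** The descent applies to the pair (2 y, x - k y).  The parity of k enters
    only to extract the factor 3 of the index from the evenness of 2 y; the
    converse is Cassini's identity read backwards. *)
Lemma pell_genFib (k x y : int) :
    0 < k -> ~~ (2 %| k)%Z ->
  ([/\ 0 < x, 0 < y & x ^+ 2 - (k ^+ 2 + 4) * y ^+ 2 = -1]) <->
  exists n : nat, [/\ (1 <= n)%N, 2 * x = genLucas k 1 (6 * n - 3) &
                      2 * y = genFib k 1 (6 * n - 3)].
Proof.
move=> k0 k_odd; split=> [[x0 y0 pell]|[[|n] [] // _ xE yE]].
- pose z := x - k * y; have xE : x = k * y + z by rewrite /z; ring.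
  have norm1 : (2 * y) ^+ 2 - k * (2 * y) * z - z ^+ 2 = 1.
    by rewrite -[RHS]opprK -pell xE; ring.
  have z0 : 0 <= z.
    (* If z < 0 then z ^ 2 + 2 k y z = z (x + k y) < 0, whereas the equation
       makes it equal to 4 y ^ 2 - 1 > 0. *)
    rewrite leNgt; apply/negP=> z_lt0.
    have : z * (x + k * y) = 4 * y ^+ 2 - 1.
      by rewrite -[X in _ - X]norm1 xE; ring.
    have ky : 0 < k * y by rewrite mulr_gt0.
    have : z * (x + k * y) < 0 by rewrite nmulr_rlt0 // addr_gt0.
    have : 0 < y ^+ 2 by rewrite exprn_gt0.
    lia.
  have y20 : 0 < 2 * y by lia.
  have [|m [yE zE]] := unit_norm_genFib k0 y20 z0; first by rewrite norm1.
  have m_even : ~~ odd m.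
    apply/negP=> m_odd; move: (genFib_cassini k 1 m).
    rewrite -yE -zE mul1r norm1 -signr_odd m_odd expr1; lia.
  have m3 : (3 %| m.+1)%N by rewrite -(even_genFib _ k_odd) -yE dvdz_mulr.
  have [n [n1 mE]] : exists n, (1 <= n)%N /\ (6 * n - 3 = m.+1)%N.
    by exists ((m + 4) %/ 6)%N; lia.
  by exists n; rewrite mE genLucasE -yE -zE; split=> //; rewrite xE; ring.
- have nE : (6 * n.+1 - 3 = (6 * n).+3)%N by lia.
  rewrite nE in xE yE; set m := (6 * n).+2 in xE yE.
  have y0 : 0 < y by have := genFib_gt0 m k0 ler01; rewrite -yE; lia.
  have z0 : 0 <= genFib k 1 m by rewrite genFib_ge0 ?ltW.
  rewrite genLucasE -yE in xE.
  have {}xE : x = k * y + genFib k 1 m by lia.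
  split=> //; first by rewrite xE ltr_wpDr ?mulr_gt0.
  have := genFib_cassini k 1 m.
  have -> : (-1 : int) ^+ m = 1.
    by rewrite -signr_odd /m /= oddM.
  by rewrite -yE => cassini; rewrite -[X in _ = - X]cassini xE; ring.
Qed.

Theorem theorem8 (k : int) (k_gt1 : 1 < k) (k_odd : ~~ (2 %| k)%Z)
    (d : int) (d_def : d = k ^+ 2 + 4) (x y : rat) :
  ([/\ x \is a Num.int, y \is a Num.int, 0 < x & 0 < y] /\
   x ^+ 2 - d%:~R * y ^+ 2 = -1) <->
  exists n : nat,
    [/\ (1 <= n)%N,
        x = (genLucas k 1 (6 * n - 3))%:~R / 2 &
        y = (genFib k 1 (6 * n - 3))%:~R / 2].
Proof.
have k0 : 0 < k by lia.
have halfE (a b : int) : 2 * a = b -> a%:~R = b%:~R / 2 :> rat.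
  by move=> <-; rewrite intrM mulrAC mulfV ?mul1r.
have pell_int (a b : int) :
    (a%:~R ^+ 2 - d%:~R * b%:~R ^+ 2 = -1 :> rat) <->
    a ^+ 2 - (k ^+ 2 + 4) * b ^+ 2 = -1.
  have -> : a%:~R ^+ 2 - d%:~R * b%:~R ^+ 2 =
      (a ^+ 2 - d * b ^+ 2)%:~R :> rat by rewrite intrB intrM !rmorphXn.
  by rewrite d_def; split=> [|->] //; rewrite -[-1]/((-1)%:~R) => /intr_inj.
split.
- case=> -[/intrP[a ->] /intrP[b ->]]; rewrite !ltr0z => a0 b0 /pell_int pell.
  have [n [n1 aE bE]] := (pell_genFib a b k0 k_odd).1 (And3 a0 b0 pell).
  by exists n; split=> //; apply: halfE.
- case=> n [n1 -> ->]; set m := (6 * n - 3)%N.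
  have mE : m = m.-1.+1 by lia.
  have U2 : (2 %| genFib k 1 m)%Z by rewrite even_genFib //; lia.
  have V2 : (2 %| genLucas k 1 m)%Z.
    by rewrite mE genLucasE -mE mulr1 rpredD ?(dvdz_mull _ U2) // dvdz_mulr.
  have aE : 2 * (genLucas k 1 m %/ 2)%Z = genLucas k 1 m by lia.
  have bE : 2 * (genFib k 1 m %/ 2)%Z = genFib k 1 m by lia.
  have [|a0 b0 pell] :=
    (pell_genFib (genLucas k 1 m %/ 2)%Z (genFib k 1 m %/ 2)%Z k0 k_odd).2.
    by exists n.
  rewrite -(halfE _ _ aE) -(halfE _ _ bE) !ltr0z; split; last exact/pell_int.
  by split=> //; apply: intr_int.
Qed.
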